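(* Let $A \in \mathcal{P}(\mathbb{N})$ be non-empty, and let $$A' = \{x \in A : \mathrm{stretch}(A,x) \text{ is odd}\} \;\cup\; \{y \in \mathbb{N}\setminus A : y > 0 \text{ and } \mathrm{stretch}(A,y-1) \text{ is odd}\}.$$ Then $A \oplus A' = \emptyset$.
   Context: $\mathbb{N} = \{0,1,2,3,\ldots\}$ is the set of non-negative integers and $\mathcal{P}(\mathbb{N})$ is its power set. For $A \in \mathcal{P}(\mathbb{N})$ let $A+1 = \{a+1 : a \in A\}$. For $A,B \in \mathcal{P}(\mathbb{N})$ let $A \,\triangle\, B = (A\setminus B)\cup(B\setminus A)$ be the symmetric difference. The binary operation $\oplus : \mathcal{P}(\mathbb{N})\times\mathcal{P}(\mathbb{N}) \to \mathcal{P}(\mathbb{N})$ is defined by $$A \oplus B := (A \,\triangle\, B)\,\triangle\,((A\cap B)+1).$$ For $a \le b$ in $\mathbb{N}$, $[a,b]$ denotes the finite set of integers $x$ with $a \le x \le b$. For $A \in \mathcal{P}(\mathbb{N})$ and $n \in \mathbb{N}$, the (backward) stretch of $A$ with respect to $n$ is the natural number defined by $\mathrm{stretch}(A,n) = 0$ if $n \notin A$, and $\mathrm{stretch}(A,n) = \max\{k \in \mathbb{N} : k \le n,\ [n-k,n] \subseteq A\} + 1$ if $n \in A$. A number $n \in \mathbb{N}$ is called odd if $n = 2k+1$ for some $k \in \mathbb{N}$. *)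

(* Defs.v *)
From mathcomp Require Import all_boot.
From mathcomp Require Import boolp classical_sets.

Set Implicit Arguments.
Unset Strict Implicit.
Unset Printing Implicit Defensive.

Local Open Scope classical_set_scope.
Local Open Scope nat_scope.

Definition shift1 (A : set nat) : set nat := [set a.+1 | a in A].

Definition oplus (A B : set nat) : set nat :=
  (A `+` B) `+` shift1 (A `&` B).

Definition natint (a b : nat) : set nat := [set x | a <= x <= b].

(* When n \in A the index k = 0 qualifies, so the \max (whose value on an
   empty range is 0) is a genuine maximum. *)
Definition stretch (A : set nat) (n : nat) : nat :=
  if n \in A
  then (\max_(k < n.+1 | `[< natint (n - k) n `<=` A >]) k).+1
  else 0.

(* Main.v *)
(** Writing [s n] for the parity of [stretch A n], the recursion
    [stretch A n.+1 = (stretch A n).+1] for [n.+1] in [A] gives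
    [s n.+1 = ~~ s n] there, while [s n] says exactly that [n] lies in
    [A `&` A'], i.e. that [n.+1] lies in its shift; so at each position an
    even number of the three sets [A], [A'], [shift1 (A `&` A')] is hit. *)
Require Import Defs.
From mathcomp Require Import all_boot.
From mathcomp Require Import boolp classical_sets.

Local Open Scope classical_set_scope.
Local Open Scope nat_scope.

(** The witness [i0] rules out the empty range, on which the left side is 0 and the right side 1. *)
Lemma bigmax_succ (I : finType) (P : pred I) (F : I -> nat) (i0 : I) :
  P i0 -> \max_(i | P i) (F i).+1 = (\max_(i | P i) F i).+1.
Proof.
move=> Pi0; have lt_max i : P i -> F i < \max_(j | P j) (F j).+1.
  by move=> Pi; apply: (@leq_bigmax_cond _ P (fun j => (F j).+1)).
apply/eqP; rewrite eqn_leq; apply/andP; split.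
  by apply/bigmax_leqP => i Pi; rewrite ltnS; apply: leq_bigmax_cond.
have max_gt0 := leq_ltn_trans (leq0n _) (lt_max _ Pi0).
rewrite -(prednK max_gt0) ltnS; apply/bigmax_leqP => i Pi.
by rewrite -ltnS prednK // lt_max.
Qed.

Lemma stretch_notin (A : set nat) n : ~ A n -> stretch A n = 0.
Proof. by move=> An; rewrite /stretch memNset. Qed.

Lemma stretch0 (A : set nat) : A 0 -> stretch A 0 = 1.
Proof.
move=> A0; rewrite /stretch mem_set //; congr _.+1.
apply/eqP; rewrite -leqn0; apply/bigmax_leqP => i _.
by rewrite -ltnS.
Qed.

Lemma natint_succ_sub (A : set nat) m n : A n.+1 ->
  (natint m n.+1 `<=` A) <-> (natint m n `<=` A).
Proof.
move=> An1; split=> sub x /andP[le_mx le_xn].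
  by apply: sub; rewrite /natint /= le_mx leqW.
move: le_xn; rewrite leq_eqVlt => /predU1P[-> //|lt_xn].
by apply: sub; rewrite /natint /= le_mx -ltnS.
Qed.

Lemma stretchS (A : set nat) n : A n.+1 -> stretch A n.+1 = (stretch A n).+1.
Proof.
move=> An1; rewrite /stretch (mem_set An1); congr _.+1.
(* Index 0 contributes 0 to the maximum and is split off; index [k.+1] at [n.+1] and index [k] at
   [n] give intervals with the same left end [n - k]. *)
rewrite big_mkcond big_ord_recl /= if_same max0n -big_mkcond /=.
under eq_bigl => k do
  rewrite /bump /= add1n subSS (asbool_equiv_eq (natint_succ_sub _ _ _ An1)).
case: (pselect (A n)) => An.
  rewrite mem_set //; under eq_bigr => k _ do rewrite /bump /= add1n.
  apply: (bigmax_succ _ _ (fun k : 'I_n.+1 => k : nat) ord0).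
  apply/asboolP => x; rewrite /natint /= subn0 => /andP[le_nx le_xn].
  by have -> : x = n by apply/eqP; rewrite eqn_leq le_xn.
(* Each interval [natint (n - k) n] contains [n], so no index qualifies and the empty maximum 0
   matches the value of [stretch] outside [A]. *)
rewrite memNset // big_pred0 // => k; apply/asboolP => sub.
by apply: An; apply: sub; rewrite /natint /= leq_subr leqnn.
Qed.

Theorem proposition4p2 (A A' : set nat) (hA : A !=set0)
    (hA' : A' = [set x | A x /\ odd (stretch A x)] `|`
                [set y | (~` A) y /\ 0 < y /\ odd (stretch A (y - 1))]) :
  oplus A A' = set0.
Proof.
have A'in x : A x -> A' x <-> odd (stretch A x).
  by move=> Ax; rewrite hA'; split=> [[[]|[]]//|]; left.
have A'out y : ~ A y.+1 -> A' y.+1 <-> odd (stretch A y).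
  move=> Ay; rewrite hA' /setU /= subn1.
  by split=> [[[]|[_ []]]//|]; right.
have A'0 : ~ A 0 -> ~ A' 0 by move=> A0; rewrite hA' => -[[]|[_ []]].
have carry n : shift1 (A `&` A') n.+1 <-> odd (stretch A n).
  split=> [[m [Am A'm] [<-]]|odd_n]; first exact/A'in.
  (* Outside [A] the stretch is 0, which is even. *)
  have An : A n by apply: contrapT => /stretch_notin En; rewrite En in odd_n.
  by exists n => //; split=> //; apply/A'in.
have no_carry : ~ shift1 (A `&` A') 0 by case.
apply/seteqP; split=> // -[|n]; rewrite /oplus /setY /setU /setD /=.
  case: (pselect (A 0)) => A0; last by have := A'0 A0; tauto.
  by have : A' 0 by [apply/(A'in _ A0); rewrite stretch0]; tauto.
have := carry n; case: (pselect (A n.+1)) => An1.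
  (* Inside [A], exactly one of [A'] and the carry holds at [n.+1]; outside [A], both or neither
     do. *)
  have := A'in _ An1; rewrite stretchS //=.
  by case: (odd _) => /=; intuition.
by have := A'out _ An1; tauto.
Qed.
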